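(* Let $P_2=ENEN$ and $P_5=NENE$, and for $k\in\{2,5\}$ let $$F_k(x,t)=1+\sum_{n\ge 1}t^n\sum_{L\in\mathcal{L}_n}x^{P_k\text{-mch}(L)}.$$ Then $$F_2(x,t)=F_5(x,t)=\frac{-(\sqrt{1-4t}-1)\,(\sqrt{1-4t}\,x-\sqrt{1-4t}-x+3)}{2\,(\sqrt{1-4t}\,xt-xt-\sqrt{1-4t}\,t+5t+\sqrt{1-4t}-1)}.$$
   Context: $\mathcal{L}_n$ is the set of lattice paths from $(0,0)$ to $(n,n)$ consisting of unit north steps $N$ and unit east steps $E$, equivalently words with $n$ letters $E$ and $n$ letters $N$. For $L\in\mathcal{L}_n$ and $A\subseteq\{1,\dots,n\}$, $ps_L(A)$ is the word obtained from $L$ by deleting, for every $i\in\{1,\dots,n\}\setminus A$, the $i$-th occurrence of $E$ and the $i$-th occurrence of $N$ (reading from left to right). For $P\in\mathcal{L}_2$, $P\text{-mch}(L)$ is the number of $j\in\{1,\dots,n-1\}$ with $ps_L(\{j,j+1\})=P$. Identities are between formal power series in $t$ with coefficients polynomial in $x$ (quotients taken in the fraction field); $\sqrt{1-4t}$ denotes the formal power series square root with constant term $1$. *)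

(* Defs.v *)
From HB Require Import structures.
From mathcomp Require Import all_boot all_order all_algebra.
From mathcomp Require Import boolp classical_sets.

Set Implicit Arguments.
Unset Strict Implicit.
Unset Printing Implicit Defensive.

Import GRing.Theory.
Local Open Scope ring_scope.

(* Formal power series in one variable, as an integral domain, so that
   quotients can be taken in {fraction fps R}. *)

Record fps (R : Type) := Fps { fcoef : nat -> R }.
Arguments Fps {R}.

HB.instance Definition _ (R : Type) := gen_eqMixin (fps R).
HB.instance Definition _ (R : Type) := gen_choiceMixin (fps R).

Lemma fpsP (R : Type) (f g : fps R) : fcoef f =1 fcoef g -> f = g.
Proof. by case: f g => [f] [g] /= /funext ->. Qed.

Section FpsRing.
Variable R : comNzRingType.
Implicit Types f g h : fps R.

Definition fps_zero : fps R := Fps (fun=> 0).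
Definition fps_opp f : fps R := Fps (fun n => - fcoef f n).
Definition fps_add f g : fps R := Fps (fun n => fcoef f n + fcoef g n).

Lemma fps_addA : associative fps_add.
Proof. by move=> f g h; apply: fpsP => n /=; rewrite addrA. Qed.
Lemma fps_addC : commutative fps_add.
Proof. by move=> f g; apply: fpsP => n /=; rewrite addrC. Qed.
Lemma fps_add0 : left_id fps_zero fps_add.
Proof. by move=> f; apply: fpsP => n /=; rewrite add0r. Qed.
Lemma fps_addN : left_inverse fps_zero fps_opp fps_add.
Proof. by move=> f; apply: fpsP => n /=; rewrite addNr. Qed.

HB.instance Definition _ := GRing.isZmodule.Build (fps R)
  fps_addA fps_addC fps_add0 fps_addN.

Definition fpsC (c : R) : fps R := Fps (fun n => if n is 0 then c else 0).
Definition fpsX : fps R := Fps (fun n => (n == 1)%N%:R).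

Definition fps_mul f g : fps R :=
  Fps (fun n => \sum_(i < n.+1) fcoef f i * fcoef g (n - i)).

Definition fps_trunc (m : nat) f : {poly R} := \poly_(i < m) fcoef f i.

Lemma coef_fps_trunc m f i : (i < m)%N -> (fps_trunc m f)`_i = fcoef f i.
Proof. by move=> lt_im; rewrite coef_poly lt_im. Qed.

Lemma fcoef_mul_trunc m f g n : (n < m)%N ->
  fcoef (fps_mul f g) n = (fps_trunc m f * fps_trunc m g)`_n.
Proof.
move=> lt_nm; rewrite coefM /=; apply: eq_bigr => i _.
have le_in : (i <= n)%N by rewrite -ltnS.
by rewrite !coef_fps_trunc // (leq_ltn_trans _ lt_nm) // leq_subr.
Qed.

Lemma fps_mulC : commutative fps_mul.
Proof.
by move=> f g; apply: fpsP => n; rewrite !(@fcoef_mul_trunc n.+1) // mulrC.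
Qed.

Lemma fps_mulA : associative fps_mul.
Proof.
move=> f g h; apply: fpsP => n.
transitivity ((fps_trunc n.+1 f * fps_trunc n.+1 g * fps_trunc n.+1 h)`_n).
  rewrite -mulrA coefM; apply: eq_bigr => i _.
  have lt_ni : (n - i < n.+1)%N by rewrite ltnS leq_subr.
  by rewrite (fcoef_mul_trunc _ _ lt_ni) coef_fps_trunc.
rewrite coefM; apply: eq_bigr => i _.
by rewrite (fcoef_mul_trunc _ _ (ltn_ord i)) coef_fps_trunc // ltnS leq_subr.
Qed.

Lemma fps_mul1 : left_id (fpsC 1) fps_mul.
Proof.
move=> f; apply: fpsP => n /=.
by rewrite big_ord_recl /= mul1r subn0 big1 ?addr0 // => i _; rewrite mul0r.
Qed.

Lemma fps_mulD : left_distributive fps_mul fps_add.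
Proof.
move=> f g h; apply: fpsP => n /=; rewrite -big_split /=.
by apply: eq_bigr => i _; rewrite mulrDl.
Qed.

Lemma fps_one_neq0 : fpsC 1 != 0.
Proof.
apply/eqP => /(congr1 (fun f : fps R => fcoef f 0)) /eqP.
by rewrite /= oner_eq0.
Qed.

HB.instance Definition _ := GRing.Zmodule_isComNzRing.Build (fps R)
  fps_mulA fps_mulC fps_mul1 fps_mulD fps_one_neq0.

Lemma fcoef0 n : fcoef (0 : fps R) n = 0. Proof. by []. Qed.
Lemma fcoefN f n : fcoef (- f) n = - fcoef f n. Proof. by []. Qed.
Lemma fcoefD f g n : fcoef (f + g) n = fcoef f n + fcoef g n.
Proof. by []. Qed.
Lemma fcoefB f g n : fcoef (f - g) n = fcoef f n - fcoef g n.
Proof. by []. Qed.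
Lemma fcoefM f g n :
  fcoef (f * g) n = \sum_(i < n.+1) fcoef f i * fcoef g (n - i).
Proof. by []. Qed.
Lemma fcoef1 n : fcoef (1 : fps R) n = (n == 0)%N%:R.
Proof. by case: n. Qed.
Lemma fcoefMn f k n : fcoef (f *+ k) n = fcoef f n *+ k.
Proof. by elim: k => // k IHk; rewrite !mulrS fcoefD IHk. Qed.

Definition fps_unit : {pred fps R} := fun f => `[< exists g, g * f = 1 >].
Definition fps_inv f : fps R := xget f [set g | g * f = 1].

Lemma fps_mulV : {in fps_unit, left_inverse 1 fps_inv *%R}.
Proof.
move=> f /asboolP[g gf1].
by apply: (xgetPex f (P := [set g | g * f = 1])); exists g.
Qed.

Lemma fps_unitP f g : g * f = 1 -> fps_unit f.
Proof. by move=> gf1; apply/asboolP; exists g. Qed.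

Lemma fps_inv_out : {in [predC fps_unit], fps_inv =1 id}.
Proof.
move=> f /asboolP nuf.
by apply: xgetPN => g gf1; apply: nuf; exists g.
Qed.

HB.instance Definition _ := GRing.ComNzRing_hasMulInverse.Build (fps R)
  fps_mulV fps_unitP fps_inv_out.

End FpsRing.
Arguments fpsX {R}.

Section FpsDomain.
Variable R : idomainType.
Implicit Types f g : fps R.

Lemma fps_order f : f != 0 ->
  exists2 i, fcoef f i != 0 & forall j, (j < i)%N -> fcoef f j = 0.
Proof.
move=> nz_f; have ex_f : exists i, fcoef f i != 0.
  apply: contrapT => nex; case/eqP: nz_f; apply: fpsP => i.
  by apply: contrapT => /eqP fi; apply: nex; exists i.
case: (ex_minnP ex_f) => i fi min_i; exists i => // j lt_ji.
by apply/eqP; apply: contraTT lt_ji => /min_i; rewrite -leqNgt.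
Qed.

Lemma fps_idomain f g : f * g = 0 -> (f == 0) || (g == 0).
Proof.
move=> fg0; case: eqP => //= /eqP /fps_order[i fi min_i].
apply/negP => /negP /fps_order[j gj min_j].
have /eqP := congr1 (fun h : fps R => fcoef h (i + j)) fg0.
have lt_i : (i < (i + j).+1)%N by rewrite ltnS leq_addr.
rewrite fcoefM fcoef0 (bigD1 (Ordinal lt_i)) //= addKn big1 => [|k ne_ki].
  by rewrite addr0 mulf_eq0 (negbTE fi) (negbTE gj).
have [lt_ki|lt_ik|eq_ki] := ltngtP k i.
- by rewrite min_i // mul0r.
- rewrite (min_j (i + j - k)%N) ?mulr0 // ltn_subLR ?ltn_add2r //.
  by rewrite -ltnS.
- by case/eqP: ne_ki; apply: val_inj.
Qed.

HB.instance Definition _ := GRing.ComUnitRing_isIntegral.Build (fps R)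
  fps_idomain.

End FpsDomain.

Notation tofrac := (@FracField.tofrac _).

(* The square root of [a] with constant term 1; by [fps_sqrtP] and
   [fps_sqrt_unique] it exists and is unique as soon as [a] has constant
   term 1 and 2 is invertible in [R]. *)
Definition fps_sqrt (R : idomainType) (a : fps R) : fps R :=
  xget 0 [set s : fps R | s ^+ 2 = a /\ fcoef s 0 = 1].

Section FpsSqrt.
Variables (R : idomainType) (a : fps R).
Hypotheses (unit2 : (2 : R) \is a GRing.unit) (a0 : fcoef a 0 = 1).

Let next (l : seq R) : R :=
  (fcoef a (size l) - \sum_(1 <= i < size l) l`_i * l`_(size l - i)) / 2.
Let prefix n := iter n (fun l => rcons l (next l)) [:: 1].
Let s := Fps (fun n => (prefix n)`_n).

Let size_prefix n : size (prefix n) = n.+1.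
Proof. by elim: n => //= n IHn; rewrite size_rcons IHn. Qed.

Let prefixE n m : (m <= n)%N -> (prefix n)`_m = fcoef s m.
Proof.
elim: n => [|n IHn]; first by rewrite leqn0 => /eqP->.
rewrite leq_eqVlt => /predU1P[->//|lt_mn].
by rewrite /= nth_rcons size_prefix lt_mn IHn.
Qed.

Lemma fps_sqrt_ex : exists r : fps R, r ^+ 2 = a /\ fcoef r 0 = 1.
Proof.
exists s; split => //; apply: fpsP => -[|n].
  by rewrite expr2 fcoefM big_ord1 /= a0 mulr1.
have sE : fcoef s n.+1 * 2 =
    fcoef a n.+1 - \sum_(1 <= i < n.+1) fcoef s i * fcoef s (n.+1 - i).
  rewrite {1}/s /= nth_rcons size_prefix ltnn eqxx /next size_prefix mulrVK //.
  congr (_ - _); apply: eq_big_nat => i /andP[i_gt0 lt_in].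
  rewrite !prefixE //; case: i i_gt0 {lt_in} => // i _.
  by rewrite subSS leq_subr.
have s0 : fcoef s 0 = 1 by [].
rewrite expr2 fcoefM; move: (fcoef s) sE s0 => c cE c0.
rewrite -(big_mkord xpredT (fun i => c i * c (n.+1 - i)%N)).
rewrite big_nat_recr //= big_ltn // subn0 subnn c0 mul1r mulr1.
by rewrite addrAC -mulr2n -mulr_natr cE subrK.
Qed.

Lemma fps_sqrtP : fps_sqrt a ^+ 2 = a /\ fcoef (fps_sqrt a) 0 = 1.
Proof.
exact: (xgetPex 0 (P := [set s : fps R | s ^+ 2 = a /\ fcoef s 0 = 1]))
  fps_sqrt_ex.
Qed.

Lemma fps_sqrt_unique (r : fps R) :
  r ^+ 2 = a -> fcoef r 0 = 1 -> r = fps_sqrt a.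
Proof.
case: fps_sqrtP => q2 q0 r2 r0; have /eqP := etrans r2 (esym q2).
rewrite eqf_sqr => /predU1P[//|/eqP/(congr1 (fun f : fps R => fcoef f 0))].
rewrite fcoefN r0 q0 => /eqP; rewrite -addr_eq0 -mulr2n => /eqP two0.
by move: unit2; rewrite two0 unitr0.
Qed.

End FpsSqrt.

Inductive step := E | N.

Definition bool_of_step (c : step) : bool := if c is E then true else false.
Definition step_of_bool (b : bool) : step := if b then E else N.
Lemma bool_of_stepK : cancel bool_of_step step_of_bool. Proof. by case. Qed.
HB.instance Definition _ := Finite.copy step (can_type bool_of_stepK).

Definition lattice_paths (n : nat) : {set (n + n).-tuple step} :=
  [set L : (n + n).-tuple step | (count_mem E L == n) && (count_mem N L == n)].

(* The letter at (0-based) position [p] of [L] is the [i]-th occurrence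
   (1-based) of that letter for [i = occ L p]. *)
Definition occ (L : seq step) (p : nat) : nat :=
  count_mem (nth E L p) (take p.+1 L).

Definition ps (L : seq step) (A : {pred nat}) : seq step :=
  [seq nth E L p | p <- iota 0 (size L) & occ L p \in A].

Definition mch (n : nat) (P L : seq step) : nat :=
  count (fun j => ps L (pred2 j j.+1) == P) (index_iota 1 n).

Definition mch_gf (P : seq step) : fps {poly rat} :=
  1 + Fps (fun n => if (0 < n)%N
                    then \sum_(L in lattice_paths n) 'X ^+ mch n P L else 0).

Definition P2 : seq step := [:: E; N; E; N].
Definition P5 : seq step := [:: N; E; N; E].

(* Main.v *)
Require Import Defs.
From HB Require Import structures.
From mathcomp Require Import all_boot all_order all_algebra.
From mathcomp Require Import zify ring.
Import GRing.Theory.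
Local Open Scope ring_scope.

(** The pattern NENE occurs at j exactly when L visits the diagonal at (j,j)
    coming from the side of N and leaving to that side.  Let U_h and V_h count
    the completions of a path at distance h from the diagonal on the side of N
    or of E: t^n stands for h + 2n remaining steps and x for one such visit.
    Then U_(h+1) = t U_(h+2) + U_h forces U_1 = c U_0, where
    c = 1 + t c^2, and likewise V_1 = c V_0.  With s = 1 - 2tc, the equations
    at height 0, U_0 = 1 + tc (x U_0 + V_0) and V_0 = 1 + tc (U_0 + V_0), give
    V_0 (s + t - xt) = 1 + (1 - x) tc.  Exchanging E and N turns NENE into
    ENEN. *)

(** * Multiplication by [fpsX] and the recurrence along the height *)

Section Shift.
Variable R : comNzRingType.
Implicit Types f : fps R.

Lemma fcoefXM0 f : fcoef (fpsX * f) 0 = 0.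
Proof. by rewrite fcoefM big_ord1 mul0r. Qed.

Lemma fcoefXMS f n : fcoef (fpsX * f) n.+1 = fcoef f n.
Proof.
rewrite fcoefM big_ord_recl /= mul0r add0r big_ord_recl /= mul1r subn1 /=.
by rewrite big1 ?addr0 // => i _; rewrite mul0r.
Qed.

Lemma fcoefCM c f n : fcoef (fpsC c * f) n = c * fcoef f n.
Proof.
rewrite fcoefM big_ord_recl /= subn0 big1 ?addr0 // => i _.
by rewrite mul0r.
Qed.

(** Induction on the coefficient, then on the height: the term with factor [fpsX] involves only an
    earlier coefficient, so it does not matter that it sits at a greater height. *)
Lemma ladder_eq0 (f : nat -> fps R) :
  f 0 = 0 -> (forall h, f h.+1 = fpsX * f h.+2 + f h) -> forall h, f h = 0.
Proof.
move=> f0 fS; suff coef0 k h : fcoef (f h) k = 0 by move=> h; apply: fpsP.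
elim: k h => [|k IHk]; elim=> [|h IHh]; rewrite ?f0 // fS fcoefD IHh addr0.
  exact: fcoefXM0.
by rewrite fcoefXMS.
Qed.

(** The equation for [c] makes [c ^+ h * f 0] a solution of the same recurrence with the same start,
    so the difference of the two solutions vanishes. *)
Lemma ladder_ratio (f : nat -> fps R) (c : fps R) :
  c = 1 + fpsX * c ^+ 2 -> (forall h, f h.+1 = fpsX * f h.+2 + f h) ->
  f 1 = c * f 0.
Proof.
move=> cE fS; apply/eqP; rewrite -subr_eq0 -(expr1 c).
rewrite (@ladder_eq0 (fun h => f h - c ^+ h * f 0)) // => [|h].
  by rewrite mul1r subrr.
have -> : c ^+ h.+1 = c ^+ h + fpsX * c ^+ h.+2.
  by rewrite exprS {1}cE !exprS; ring.
by rewrite fS; ring.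
Qed.

End Shift.

(** * The Catalan series behind the square root *)

Lemma fpsX_neq0 (R : comNzRingType) : fpsX != 0 :> fps R.
Proof.
by apply/eqP=> /(congr1 (fun f : fps R => fcoef f 1)) /eqP; rewrite oner_eq0.
Qed.

Lemma catalan_quotient (R : idomainType) (s : fps R) :
  (2 : R) \is a GRing.unit ->
  s ^+ 2 = 1 - 4%:R * fpsX -> fcoef s 0 = 1 ->
  exists2 c, s = 1 - 2%:R * fpsX * c & c = 1 + fpsX * c ^+ 2.
Proof.
move=> unit2 s2 s0; pose half : fps R := fpsC 2^-1.
have halfE : 2%:R * half = 1.
  apply: fpsP => -[|n]; rewrite mulr_natl fcoefMn fcoef1 /= ?mul0rn //.
  by rewrite -[_^-1 *+ 2]mulr_natl divrr.
(* This is [(1 - s) / (2 * fpsX)]: the shift drops the constant term of [s], which is 1. *)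
pose c := half * Fps (fun n => - fcoef s n.+1).
have sc : s = 1 - 2%:R * fpsX * c.
  rewrite (_ : _ * c = fpsX * Fps (fun n => - fcoef s n.+1)); last first.
    by rewrite /c; ring: halfE.
  apply: fpsP => -[|n]; rewrite fcoefB fcoef1 ?fcoefXM0 ?fcoefXMS ?s0 ?subr0 //.
  by rewrite /= sub0r opprK.
exists c => //; apply/eqP; rewrite -subr_eq0; apply/eqP.
apply: (mulfI (fpsX_neq0 R)); rewrite mulr0.
(* The factor 1 is written as [(2%:R * half) ^+ 2] because four times the left side is
   [1 - 4%:R * fpsX - s ^+ 2]. *)
have -> : fpsX * (c - (1 + fpsX * c ^+ 2)) =
    (2%:R * half) ^+ 2 * (fpsX * (c - (1 + fpsX * c ^+ 2))).
  by rewrite halfE expr1n mul1r.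
transitivity (half ^+ 2 * (1 - 4%:R * fpsX - s ^+ 2)).
  by rewrite sc; ring.
by rewrite s2 subrr mulr0.
Qed.

Lemma fps_neq0 (R : comNzRingType) (f : fps R) : fcoef f 0 != 0 -> f != 0.
Proof. by apply: contraNneq => ->. Qed.

(** * Words in [E] and [N], and the exchange of the two letters *)

Section Words.

Lemma step_eqE (c d : step) : (c == d) = (bool_of_step c == bool_of_step d).
Proof. by apply/eqP/eqP => [->//|]; case: c; case: d. Qed.

Lemma count_steps (L : seq step) :
  (count_mem E L + count_mem N L)%N = size L.
Proof. by elim: L => //= c L <-; rewrite !step_eqE; case: c => /=; lia. Qed.

Definition swap (c : step) : step := if c is E then N else E.

Lemma swapK : involutive swap. Proof. by case. Qed.

Lemma count_swap (c : step) (L : seq step) : count_mem c (map swap L) = count_mem (swap c) L.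
Proof.
by rewrite count_map; apply: eq_count => d; rewrite /= !step_eqE; case: c; case: d.
Qed.

Lemma occ_swap (L : seq step) p : (p < size L)%N -> occ (map swap L) p = occ L p.
Proof.
by move=> ltp; rewrite /occ (nth_map E) // -map_take count_swap swapK.
Qed.

Lemma ps_swap (L : seq step) A : ps (map swap L) A = map swap (ps L A).
Proof.
rewrite /ps size_map -map_comp.
rewrite (@eq_in_filter _ _ (fun p => occ L p \in A)) => [|p]; last first.
  by rewrite mem_iota => ltp; rewrite occ_swap.
apply/eq_in_map => p; rewrite mem_filter mem_iota add0n => /and3P[_ _ ltp].
by rewrite /= (nth_map E).
Qed.

Lemma mch_swap n P (L : seq step) : mch n (map swap P) (map swap L) = mch n P L.
Proof.
apply: eq_count => j; rewrite ps_swap inj_eq //.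
exact: (inj_map (can_inj swapK)).
Qed.

(** Reflection in the diagonal permutes the paths of each size and keeps every occurrence number,
    hence commutes with [ps]. *)
Lemma mch_gf_swap P : mch_gf (map swap P) = mch_gf P.
Proof.
congr (1 + _); apply: fpsP => n /=; case: ifP => // _.
have swtK : involutive (map_tuple swap : (n + n).-tuple step -> _).
  by move=> L; apply: val_inj; rewrite /= mapK //; apply: swapK.
rewrite (reindex_inj (can_inj swtK)) /=; apply: eq_big => L.
  by rewrite !inE !count_swap andbC.
by rewrite mch_swap.
Qed.

(** * Matches of [P5] as visits of the diagonal *)

Lemma ps_rcons (L : seq step) (c : step) A :
  ps (rcons L c) A =
  if (count_mem c L).+1 \in A then rcons (ps L A) c else ps L A.
Proof.
rewrite {1}/ps size_rcons -addn1 iotaD add0n cats1 filter_rcons.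
have -> : occ (rcons L c) (size L) = (count_mem c L).+1.
  rewrite /occ nth_rcons ltnn eqxx take_oversize ?size_rcons //.
  by rewrite -cats1 count_cat /= eqxx addn1.
have <- : [seq nth E (rcons L c) p | p <- iota 0 (size L)
            & occ (rcons L c) p \in A] = ps L A.
  rewrite (@eq_in_filter _ _ (fun p => occ L p \in A)) => [|p]; last first.
    rewrite mem_iota add0n => /andP[_ ltp]; rewrite /occ nth_rcons ltp.
    by rewrite -cats1 takel_cat.
  apply/eq_in_map => p; rewrite mem_filter mem_iota add0n => /and3P[_ _ ltp].
  by rewrite nth_rcons ltp.
by case: ifP => // _; rewrite map_rcons nth_rcons ltnn eqxx.
Qed.

(** Whether a letter is deleted depends only on the letters up to it. *)
Lemma prefix_ps (u v : seq step) A : prefix (ps u A) (ps (u ++ v) A).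
Proof.
elim/last_ind: v => [|v c IHv]; first by rewrite cats0 prefix_refl.
rewrite -rcons_cat ps_rcons; case: ifP => // _.
exact: prefix_trans IHv (prefix_rcons _ _).
Qed.

(** Meant also for prefixes of a path, where it tells how much of the pattern has been read. *)
Lemma count_ps2 (c : step) (L : seq step) j : (0 < j)%N ->
  count_mem c (ps L (pred2 j j.+1)) =
  ((j <= count_mem c L) + (j < count_mem c L))%N.
Proof.
move=> j0; elim/last_ind: L => [|L d IHL]; first by rewrite /=; lia.
rewrite ps_rcons -[in RHS]cats1 count_cat /= addn0.
have [eq_dc|ndc] := eqVneq d c; first subst d.
  case: ifP; rewrite !inE -?cats1 ?count_cat /= ?eqxx IHL; move: (count_mem c L) => m {IHL}; lia.
by rewrite !addn0; case: ifP; rewrite -?cats1 ?count_cat /= ?(negbTE ndc) ?addn0.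
Qed.

(** Cut [L] after [j.*2] letters. If the first part is balanced, its last letter and the letter
    after the cut have numbers [j] and [j.+1], so they are the two middle letters of the kept word.
    Each side of the cut keeps one [E] and one [N], so these two letters determine the word. *)
Lemma ps2_P5 (L : seq step) j : (0 < j)%N ->
  (j < count_mem E L)%N -> (j < count_mem N L)%N ->
  (ps L (pred2 j j.+1) == P5) =
  [&& nth E L j.*2.-1 == E, nth E L j.*2 == N &
      count_mem E (take j.*2 L) == count_mem N (take j.*2 L)].
Proof.
move=> j0 ltE ltN; set A := pred2 j j.+1.
have szL := count_steps L.
have lt2j : (j.*2 < size L)%N by lia.
have defL := cat_take_drop j.*2 L.
have szu : size (take j.*2 L) = j.*2 by rewrite size_takel // ltnW.
have cu := etrans (count_steps (take j.*2 L)) szu.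
have sE : count_mem E (ps L A) = 2%N by rewrite count_ps2 // ltE (ltnW ltE).
have sN : count_mem N (ps L A) = 2%N by rewrite count_ps2 // ltN (ltnW ltN).
have [cEN|neEN] := eqVneq (count_mem E (take _ _)) _.
  have cj c : count_mem c (take j.*2 L) = j.
    by move: cu; case: c; rewrite ?cEN -?cEN addnn => /double_inj.
  have pre : prefix (rcons (ps (take j.*2 L) A) (nth E L j.*2)) (ps L A).
    suff -> : rcons (ps (take j.*2 L) A) (nth E L j.*2) = ps (take j.*2.+1 L) A.
      by rewrite -{2}(cat_take_drop j.*2.+1 L) prefix_ps.
    by rewrite (take_nth E) // ps_rcons cj !inE eqxx orbT.
  have [w defu] : exists w, ps (take j.*2 L) A = rcons w (nth E L j.*2.-1).
    exists (ps (take j.*2.-1 L) A).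
    have defu : take j.*2 L = rcons (take j.*2.-1 L) (nth E L j.*2.-1).
      by rewrite -take_nth ?prednK //; lia.
    rewrite {1}defu ps_rcons ifT //.
    have := cj (nth E L j.*2.-1).
    rewrite defu -cats1 count_cat /= eqxx addn0 addn1 => ->.
    by rewrite !inE eqxx.
  have := count_ps2 E (take j.*2 L) _ j0.
  have := count_ps2 N (take j.*2 L) _ j0.
  rewrite -/A !cj leqnn ltnn addn0 {}defu in pre *.
  case/prefixP: pre sE sN => z ->.
  move: (nth E L j.*2.-1) (nth E L j.*2) => d c.
  rewrite -!cats1 !count_cat /= => sE sN uN uE.
  rewrite !step_eqE in sE sN uN uE *.
  have szw : size w = 1%N by rewrite -count_steps; case: d uN uE {sE sN} => /=; lia.
  have szz : size z = 1%N by rewrite -count_steps; case: d c uN uE sE sN => [] [] /=; lia.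
  case: w szw sE sN uN uE => [|x []] // _; case: z szz => [|y []] // _ /=.
  by rewrite !step_eqE; case: x; case: d; case: c; case: y.
(* In an unbalanced first part one letter occurs more than [j] times and the other fewer than [j]
   times. What is kept of it is one letter twice, while [P5] begins with two different letters. *)
rewrite !andbF; apply/eqP => defS.
have := count_ps2 E (take j.*2 L) _ j0.
have := count_ps2 N (take j.*2 L) _ j0.
have := prefix_ps (take j.*2 L) (drop j.*2 L) A.
rewrite defL defS prefixE -/A => /eqP <-.
move: cu neEN; move: (count_mem E (take j.*2 L)) (count_mem N (take j.*2 L)) => e m.
by case: (size _) => [|[|[|[|[|k]]]]] /=; rewrite ?step_eqE /=; lia.
Qed.

(* A prefix of a path is summarised by the side [s] of the diagonal on which
   its last step ended ([true] for the side of N) and its distance [h] to the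
   diagonal, the empty prefix being [(false, 0)]; [touches] counts the visits of
   the diagonal, from there on, that both come from and leave to the side of
   N. *)
Fixpoint touches (s : bool) (h : nat) (L : seq step) : nat :=
  if L is c :: L' then
    match h with
    | 0 => (s && (c == N)) + touches (c == N) 1 L'
    | h'.+1 => touches s (if (c == N) == s then h'.+2 else h') L'
    end
  else 0.

Definition closes (s : bool) (h : nat) (L : seq step) : bool :=
  if s then (h + count_mem N L == count_mem E L)%N
  else (h + count_mem E L == count_mem N L)%N.

(* [a] and [b] are the numbers of letters E and N already read, [c] is the last
   of these letters. *)
Lemma touchesE s h a b c (L : seq step) :
  (if s then b = a + h else a = b + h)%N -> (h = 0%N -> (c == E) = s) ->
  touches s h L =
  count (fun p => [&& nth E (c :: L) p == E, nth E L p == N &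
    a + count_mem E (take p L) == b + count_mem N (take p L)]%N)
    (iota 0 (size L)).
Proof.
elim: L s h a b c => // d L IHL s h a b c ab cs /=.
rewrite (iotaDl 1 0) count_map /=.
(* The state after reading [d]: on the diagonal [d] chooses the new side, elsewhere the side is
   kept, even on arrival at the diagonal. *)
pose a' := if d is E then a.+1 else a; pose b' := if d is E then b else b.+1.
pose s' := if h is 0 then d == N else s.
pose h' := if h is h1.+1 then (if (d == N) == s then h1.+2 else h1) else 1%N.
have := IHL s' h' a' b' d.
rewrite (@eq_count _ (preim _ _) (fun p => [&& nth E (d :: L) p == E,
   nth E L p == N & a' + count_mem E (take p L) == b' + count_mem N (take p L)]%N));
  last first.
  move=> p; rewrite /= /a' /b' !step_eqE; case: d {IHL a' b' s' h'} => /=;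
    congr [&& _, _ & _]; rewrite // !(add0n, add1n) addSnnS //.
move=> <-.
- rewrite /s' /h' !addn0 ; case: h ab cs {h' s'} => [|h] ab cs.
    rewrite cs // !addn0 in ab *; congr (_ + _)%N; case: s ab {cs} => ->; by rewrite ?eqxx ?andbT.
  rewrite (_ : (a == b)%N = false) ?andbF //; case: s ab {cs} => ->; lia.
- rewrite {}/s' {}/h' {}/a' {}/b'; move: ab; rewrite !step_eqE; case: h {cs} => [|h]; case: s; case: d => /= ->; lia.
- by rewrite {}/s' {}/h' {a' b'}; case: h {ab cs} => [|h] //; rewrite !step_eqE; case: h => [|h]; case: s; case: d.
Qed.

Lemma mch_P5 n (L : seq step) : count_mem E L = n -> count_mem N L = n ->
  mch n P5 L = touches false 0 L.
Proof.
move=> cE cN; have szL := count_steps L.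
(* A fictitious [N] before the path agrees with the initial side [false]. *)
rewrite (@touchesE _ _ 0 0 N) //.
rewrite (_ : size L = n.*2); last by lia.
set Q := fun p => _.
(* The diagonal is met only after an even number of steps. *)
have odd0 p : (p < n.*2)%N -> odd p -> Q p = false.
  move=> ltp op; rewrite /Q !add0n; have := count_steps (take p L).
  rewrite size_takel; last by lia.
  move=> cp; rewrite [X in [&& _, _ & X]](_ : _ = false) ?andbF //.
  apply/eqP => eqp; move: op; rewrite -cp eqp addnn odd_double //.
have -> : count Q (iota 0 n.*2) = count (Q \o double) (iota 0 n).
  elim: (n) odd0 => // m IHm odd0.
  rewrite -(addn1 m) doubleD !iotaD !count_cat IHm => [|p ltp]; last first.
    by apply: odd0; lia.
  by rewrite /= !add0n (odd0 m.*2.+1) //= ?odd_double // !addn0.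
rewrite /mch /index_iota.
(* The start of the path does not count, since the fictitious letter before it is not [E]. *)
have -> : count (Q \o double) (iota 0 n) = count (Q \o double) (iota 1 (n - 1)).
  by case: (n) => //= m; rewrite subn1.
apply: eq_in_count => j; rewrite mem_iota => ltj.
rewrite ps2_P5 ?cE ?cN; try lia.
by rewrite /Q /= !add0n; case: j ltj.
Qed.

End Words.

(** * Generating functions of the completions of a path *)

Section Completions.
Local Notation R := {poly rat}.

Definition completions (m : nat) (s : bool) (h : nat) : R :=
  \sum_(L : m.-tuple step | closes s h L) 'X ^+ touches s h L.

Lemma big_tuple_cons (T : finType) m (F : seq T -> R) :
  \sum_(L : m.+1.-tuple T) F L = \sum_c \sum_(L : m.-tuple T) F (c :: L).
Proof.
rewrite pair_bigA /=.
rewrite (reindex (fun p : T * m.-tuple T => [tuple of p.1 :: p.2])) //=.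
exists (fun L : m.+1.-tuple T => (thead L, [tuple of behead L])) => [[c L]|L] _.
  by congr (_, _); apply: val_inj.
by rewrite -tuple_eta.
Qed.

Lemma big_step (F : step -> R) : \sum_c F c = F E + F N.
Proof.
rewrite (bigD1 E) //= (bigD1 N) //= big1 ?addr0 // => c.
by rewrite !step_eqE; case: c.
Qed.

Lemma completionsE m s h :
  completions m.+1 s h =
    \sum_(L : m.-tuple step | closes s h (E :: L)) 'X ^+ touches s h (E :: L) +
    \sum_(L : m.-tuple step | closes s h (N :: L)) 'X ^+ touches s h (N :: L).
Proof.
rewrite /completions big_mkcond.
rewrite (big_tuple_cons _ _ (fun L => if closes s h L then 'X ^+ touches s h L else 0)) big_step.
by rewrite -!big_mkcond.
Qed.

(** Off the diagonal the first letter moves away from it or towards it, and no visit is counted. *)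
Lemma completionsS m s h :
  completions m.+1 s h.+1 = completions m s h.+2 + completions m s h.
Proof.
rewrite completionsE; case: s; [rewrite addrC|]; congr (_ + _);
  apply: eq_big => L; rewrite /closes //= add0n add1n ?addSnnS //; lia.
Qed.

Lemma completions0 m s :
  completions m.+1 s 0 = 'X ^+ s * completions m true 1 + completions m false 1.
Proof.
rewrite completionsE addrC big_distrr; congr (_ + _);
  apply: eq_big => L; rewrite /closes /= ?andbT ?andbF ?exprD //;
  case: s; lia.
Qed.

Lemma completions_small m s h : (m < h)%N -> completions m s h = 0.
Proof.
move=> ltmh; apply: big_pred0 => L; rewrite /closes.
have := count_steps L; rewrite size_tuple.
move: (count_mem E L) (count_mem N L) => e n; case: s => /= en; lia.
Qed.

Lemma completions00 s : completions 0 s 0 = 1.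
Proof.
rewrite /completions (big_pred1 [tuple]) => [|L]; first by [].
by rewrite [L]tuple0 /= [RHS]eqxx; case: s.
Qed.

Definition completions_gf (s : bool) (h : nat) : fps R :=
  Fps (fun k => completions (h + k.*2) s h).

(** After one step [h + k.*2] steps remain. Seen from distance [h.+2] this is one pair of steps
    fewer, hence the factor [fpsX]; for [k = 0] they are too few to return from there. *)
Lemma completions_gfS s h :
  completions_gf s h.+1 =
  fpsX * completions_gf s h.+2 + completions_gf s h.
Proof.
apply: fpsP => -[|k]; rewrite fcoefD ?fcoefXM0 ?fcoefXMS /= addSn completionsS.
  by rewrite completions_small ?addn0.
by congr (completions _ _ _ + _); lia.
Qed.

Lemma completions_gf0 s :
  completions_gf s 0 = 1 + fpsX * (fpsC 'X ^+ s * completions_gf true 1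
                                   + completions_gf false 1).
Proof.
apply: fpsP => -[|k]; rewrite fcoefD fcoef1 ?fcoefXM0 ?fcoefXMS.
  by rewrite /= completions00 addr0.
have -> : fpsC 'X ^+ s = fpsC ('X ^+ s) :> fps R.
  by case: s.
rewrite add0r fcoefD fcoefCM; exact: completions0.
Qed.

Lemma mch_gf_P5 : mch_gf P5 = completions_gf false 0.
Proof.
apply: fpsP => -[|n]; rewrite fcoefD fcoef1 /=.
  by rewrite completions00 addr0.
rewrite add0r add0n -addnn /completions; apply: eq_big => L.
  rewrite inE /closes /= add0n; have := count_steps L; rewrite size_tuple.
  by move: (count_mem E L) (count_mem N L) => e m; lia.
rewrite inE => /andP[/eqP cE /eqP cN]; rewrite mch_P5 //.
Qed.

Lemma mch_gf_P5_eq (s c : fps R) :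
  s = 1 - 2%:R * fpsX * c -> c = 1 + fpsX * c ^+ 2 ->
  2%:R * mch_gf P5 * (s + fpsX - fpsC 'X * fpsX) =
  s * fpsC 'X - s - fpsC 'X + 3%:R.
Proof.
move=> sc cE; have ratio b : completions_gf b 1 = c * completions_gf b 0.
  by apply: ladder_ratio cE _ => h; apply: completions_gfS.
have := completions_gf0 true; have := completions_gf0 false.
rewrite mch_gf_P5 !ratio sc /= expr0 expr1 mul1r.
move: (completions_gf true 0) (completions_gf false 0) (fpsC 'X) cE => U V x.
move: fpsX => t cE VE UE; apply/eqP; rewrite -subr_eq0; apply/eqP.
(* The multipliers [1 - x * (t * c)] and [t * c] eliminate [U]; the last term trades [t * c ^+ 2]
   for [c - 1]. The factor 2 lets [2%:R * t * c] become [1 - s]. *)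
transitivity (2%:R * (
  (V - (1 + t * (c * U + c * V))) * (1 - x * (t * c)) +
  (U - (1 + t * (x * (c * U) + c * V))) * (t * c) -
  V * (1 - x) * t * (c - (1 + t * c ^+ 2)))); first by ring.
by rewrite -VE -UE -cE !subrr !(mul0r, mulr0, subr0, addr0).
Qed.

End Completions.

(** * The closed form in the fraction field *)

Theorem mainTheorem5 :
  let x : {fraction fps {poly rat}} := tofrac (fpsC 'X) in
  let t : {fraction fps {poly rat}} := tofrac fpsX in
  let s : {fraction fps {poly rat}} := tofrac (fps_sqrt (1 - 4%:R * fpsX)) in
  mch_gf P2 = mch_gf P5 /\
  tofrac (mch_gf P5) =
    (- (s - 1) * (s * x - s - x + 3%:R))
    / (2%:R * (s * x * t - x * t - s * t + 5%:R * t + s - 1)).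
Proof.
move=> x t s; split; first exact: (mch_gf_swap P5).
have unit2 : (2 : {poly rat}) \is a GRing.unit.
  by rewrite -polyC_natr poly_unitE size_polyC coefC.
have a0 : fcoef (1 - 4%:R * fpsX : fps {poly rat}) 0 = 1.
  by rewrite fcoefB fcoef1 mulrC fcoefXM0 subr0.
have [s2 s0] := fps_sqrtP unit2 a0.
rewrite {}/s {}/x {}/t; move: (fps_sqrt _) s2 s0 => s s2 s0.
have [c sc cE] := catalan_quotient _ _ unit2 s2 s0.
have FE := mch_gf_P5_eq s c sc cE.
pose x : fps {poly rat} := fpsC 'X; pose t : fps {poly rat} := fpsX.
pose den := 2%:R * (s * x * t - x * t - s * t + 5%:R * t + s - 1).
(* Thanks to [s ^+ 2 = 1 - 4%:R * t], the denominator shares the factor [1 - s] with the numerator;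
   the cofactors are those of [FE]. *)
have denE : den = 2%:R * (1 - s) * (s + t - x * t).
  by rewrite -/t in s2; rewrite /den; ring: s2.
have den0 : den != 0.
  have two0 : fcoef (2%:R : fps {poly rat}) 0 != 0.
    by rewrite fcoefMn fcoef1; apply: contraTneq unit2 => ->; rewrite unitr0.
  have c0 : fcoef c 0 != 0 by rewrite cE fcoefD fcoefXM0 fcoef1 addr0 oner_eq0.
  have sx0 : fcoef (s + t - x * t) 0 != 0.
    by rewrite fcoefB fcoefD s0 mulrC fcoefXM0 subr0 addr0 oner_eq0.
  (* The constant term of [1 - s] is zero, so it is factored first; apart from [fpsX], all factors
     then have nonzero constant term. *)
  rewrite denE (_ : 1 - s = 2%:R * fpsX * c); last by rewrite sc; ring.
  by rewrite !mulf_neq0 ?fpsX_neq0 // fps_neq0.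
have numE : mch_gf P5 * den = - (s - 1) * (s * x - s - x + 3%:R).
  by rewrite denE -FE -/x -/t; ring.
have fracE := (@tofracM, @tofracD, @tofracN, @tofracMn, @tofrac1).
apply: (@mulIf _ (tofrac den)); first by rewrite tofrac_eq0.
move: den0; rewrite -tofrac_eq0 -tofracM numE !fracE => den0.
by rewrite mulfVK.
Qed.
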